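(* Let $G,H$ be finite simple connected graphs, fix a root $(r_G,r_H)\in V(G\,\square\,H)$, and let $K\in\{G,H\}$ with $\bar K$ the other graph; write $r_{\bar K}$ for the $\bar K$-coordinate of the root. Then every configuration $c$ on $G\,\square\,H$ from which no sequence of pebbling moves places a pebble on $(r_G,r_H)$ satisfies \[ \Bigl(\sum_{j\in V(\bar K)\setminus\{r_{\bar K}\}} stack_{K,j,D_{\bar K}(j,r_{\bar K})}\Bigr)+\tilde c_{K,r_{\bar K}}+1\ \le\ \pi(K). \]
   Context: The Cartesian product $G\,\square\,H$ has vertex set $V(G)\times V(H)$, with $(g,h)\sim(g',h')$ iff ($g=g'$ and $h\sim_H h'$) or ($h=h'$ and $g\sim_G g'$). $D_X$ is graph distance in $X$. A configuration is a function $c:V(G\,\square\,H)\to\mathbb{Z}_{\ge0}$. A pebbling move removes two pebbles from a vertex and adds one to an adjacent vertex. $\pi(X)$ (pebbling number) is the least $k$ such that from every configuration of size $k$ on $X$ and every root some sequence of pebbling moves places a pebble on the root. For $K\in\{G,H\}$, $\bar K$ is the other graph; for $j\in V(\bar K)$ the $K$-slice $K_j$ is $\{(i,j):i\in V(G)\}$ if $K=G$ and $\{(j,h):h\in V(H)\}$ if $K=H$. For a configuration $c$: $\tilde c_{K,j}=\sum_{u\in K_j}c(u)$, and $stack_{K,j,d}$ is the number of (disjoint) $2^d$-stacks in $K_j$, where a $2^d$-stack is a collection of $2^d$ pebbles on a single vertex, i.e. $stack_{K,j,d}=\sum_{u\in K_j}\lfloor c(u)/2^d\rfloor$. *)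

(* Defs.v *)
From mathcomp Require Import all_boot.
From mathcomp Require Import boolp.

Set Implicit Arguments.
Unset Strict Implicit.
Unset Printing Implicit Defensive.

Record cgraph := CGraph {
  vertex :> finType;
  adj : rel vertex;
  adj_sym : symmetric adj;
  adj_irr : irreflexive adj;
  adj_conn : forall x y, connect adj x y
}.

Definition is_walk (G : cgraph) (n : nat) (x y : G) : bool :=
  [exists p : n.-tuple G, path (@adj G) x p && (last x p == y)].

Lemma ex_walk (G : cgraph) (x y : G) : exists n, is_walk n x y.
Proof.
have /connectP[p pth ->] := adj_conn x y.
exists (size p); apply/existsP; exists (in_tuple p).
by rewrite /= pth eqxx.
Qed.

Definition dist (G : cgraph) (x y : G) : nat := ex_minn (ex_walk x y).

Section CartesianProduct.
Variables G H : cgraph.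

Definition cprod_adj (u v : G * H) : bool :=
  (u.1 == v.1) && adj u.2 v.2 || (u.2 == v.2) && adj u.1 v.1.

Lemma cprod_adj_sym : symmetric cprod_adj.
Proof.
by move=> u v; rewrite /cprod_adj ![_ == v.1]eq_sym ![_ == v.2]eq_sym
  (adj_sym u.2) (adj_sym u.1).
Qed.

Lemma cprod_adj_irr : irreflexive cprod_adj.
Proof. by move=> u; rewrite /cprod_adj !adj_irr !andbF. Qed.

Lemma cprod_adj_conn (u v : G * H) : connect cprod_adj u v.
Proof.
case: u v => [g h] [g' h']; apply: (@connect_trans _ _ (g', h)).
  have /connectP[p pth ->] := adj_conn g g'.
  elim: p g pth => [|a p IHp] g //= /andP[ga pth].
  apply: connect_trans (IHp a pth); apply: connect1.
  by rewrite /cprod_adj /= ga eqxx orbT.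
have /connectP[p pth ->] := adj_conn h h'.
elim: p h pth => [|a p IHp] h //= /andP[ha pth].
apply: connect_trans (IHp a pth); apply: connect1.
by rewrite /cprod_adj /= ha eqxx.
Qed.

Definition cprod : cgraph := CGraph cprod_adj_sym cprod_adj_irr cprod_adj_conn.

End CartesianProduct.

Section Pebbling.
Variable G : cgraph.

Definition config := {ffun G -> nat}.

Definition config_size (c : config) : nat := \sum_(u : G) c u.

Definition apply_move (c : config) (u v : G) : config :=
  [ffun x => if x == u then c u - 2 else if x == v then (c v).+1 else c x].

Definition pebbling_move : rel config := fun c c' =>
  [exists u : G, exists v : G,
     [&& adj u v, 2 <= c u & c' == apply_move c u v]].

Definition can_reach (c : config) (r : G) : Prop :=
  exists2 s : seq config, path pebbling_move c s & 0 < last c s r.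

Definition always_solvable (k : nat) : Prop :=
  forall c : config, config_size c = k -> forall r : G, can_reach c r.

Lemma gather (m : nat) (c : config) (u v : G) : adj u v -> m.*2 <= c u ->
  exists2 s : seq config, path pebbling_move c s & m <= last c s v.
Proof.
move=> uv; have neq : v != u by apply: contraTneq uv => ->; rewrite adj_irr.
suff: m.*2 <= c u -> exists2 s : seq config, path pebbling_move c s &
    m + c v <= last c s v.
  by move=> IH /IH[s ? le]; exists s => //; apply: leq_trans le; rewrite leq_addr.
elim: m c => [|m IHm] c; first by exists [::].
rewrite doubleS => le; have [|s ps ls] := IHm (apply_move c u v).
  by rewrite ffunE eqxx -(leq_add2r 2) subnK ?addn2 //; apply: leq_trans le.
exists (apply_move c u v :: s) => /=.
  rewrite ps andbT; apply/existsP; exists u; apply/existsP; exists v.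
  by rewrite uv eqxx andbT; apply: leq_trans le.
by apply: leq_trans ls; rewrite ffunE (negPf neq) eqxx addnS.
Qed.

Lemma can_reach_stack (c : config) (u : G) (p : seq G) :
  path (@adj G) u p -> 2 ^ size p <= c u -> can_reach c (last u p).
Proof.
elim: p u c => [|v p IHp] u c /=; first by exists [::].
case/andP=> uv pth; rewrite expnS mul2n => /(gather uv)[s ps ls].
have [t pt lt] := IHp _ _ pth ls.
by exists (s ++ t); rewrite ?cat_path ?ps ?last_cat.
Qed.

Lemma ex_always_solvable : exists k, `[< always_solvable k >].
Proof.
exists (#|G| * 2 ^ #|G|); apply/asboolP => c sc r.
case: (pickP (fun u => 2 ^ #|G| <= c u)) => [u le|small].
  have /connectP[p0 pth0 def_r] := adj_conn u r.
  case: (shortenP pth0) def_r => p pth up _ ->.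
  apply: can_reach_stack => //; apply: leq_trans le; rewrite leq_exp2l //.
  by rewrite ltnW // -[_.+1]/(size (u :: p)) -(card_uniqP up) max_card.
have: config_size c <= \sum_(u : G) (2 ^ #|G|).-1.
  apply: leq_sum => u _; rewrite -ltnS prednK ?expn_gt0 //.
  by rewrite ltnNge small.
rewrite sc sum_nat_const leq_pmul2l; last by apply/card_gt0P; exists r.
by rewrite leqNgt prednK ?expn_gt0 ?leqnn.
Qed.

Definition pebbling_number : nat := ex_minn ex_always_solvable.

End Pebbling.

(* [InG] stands for K = G (so that the other graph is H), [InH] for K = H. *)
Inductive side := InG | InH.

Section Slices.
Variables (G H : cgraph) (K : side).

Definition factor : cgraph := if K is InG then G else H.

Definition cofactor : cgraph := if K is InG then H else G.

End Slices.

Definition coproj (G H : cgraph) (K : side) (u : cprod G H) : cofactor G H K :=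
  match K with InG => u.2 | InH => u.1 end.

Definition slice (G H : cgraph) (K : side) :
    cofactor G H K -> {set cprod G H} :=
  match K with
  | InG => fun j => [set (i, j) | i : G]
  | InH => fun j => [set (j, h) | h : H]
  end.

Definition slice_size (G H : cgraph) (K : side) (c : config (cprod G H))
    (j : cofactor G H K) : nat :=
  \sum_(u in slice j) c u.

Definition stack (G H : cgraph) (K : side) (c : config (cprod G H))
    (j : cofactor G H K) (d : nat) : nat :=
  \sum_(u in slice j) c u %/ 2 ^ d.

(* Main.v *)
Require Import Defs.
From mathcomp Require Import all_boot.
From mathcomp Require Import zify boolp.

(** Let [r] be the [K-bar]-coordinate of the root.  From a vertex [(i, j)],
    every [2^d]-stack with [d = D(j, r)] can be sent along a shortest path of
    [K-bar] to one pebble on [(i, r)].  Doing this in parallel for all stacks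
    puts a configuration on the slice over [r] whose size is the left-hand side
    minus one; if this were at least [pi(K)], the root could be reached by moves
    inside that slice, a copy of [K]. *)

Set Implicit Arguments.
Unset Strict Implicit.
Unset Printing Implicit Defensive.

(** * Domination calculus for pebbling moves *)

Section Covers.
Variable G : cgraph.
Implicit Types (c d e : config G) (u v x : G).

(** Reachability up to surplus: with domination as the target, leftover pebbles need no bookkeeping,
    and the relation is transitive and additive. *)
Definition covers c d : Prop :=
  exists2 s : seq (config G), path (@pebbling_move G) c s
    & forall x, d x <= last c s x.

Definition add_config c d : config G := [ffun x => c x + d x].

Definition pile u (k : nat) : config G := [ffun x => (x == u) * k].

Lemma can_reach_covers c r : can_reach c r <-> covers c (pile r 1).
Proof.
split=> -[s ps ls]; exists s => //; last by have := ls r; rewrite ffunE eqxx.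
by move=> x; rewrite ffunE; case: eqP => // ->.
Qed.

Lemma pebbling_move_add c c' e :
  pebbling_move c c' -> pebbling_move (add_config c e) (add_config c' e).
Proof.
case/existsP=> u /existsP[v /and3P[uv le2 /eqP->]].
apply/existsP; exists u; apply/existsP; exists v.
rewrite uv ffunE (leq_trans le2) ?leq_addr //=; apply/eqP/ffunP=> x.
rewrite !ffunE; case: (x =P u) => [->|_]; first by rewrite addnBAC.
by case: (x =P v) => [->|].
Qed.

(** The same moves are replayed while the pebbles of [e] lie idle. *)
Lemma covers_addr c d e : covers c d -> covers (add_config c e) (add_config d e).
Proof.
case=> s ps ls.
suff [t pt lt] : exists2 t, path (@pebbling_move G) (add_config c e) t
    & last (add_config c e) t = add_config (last c s) e.
  by exists t => // x; rewrite lt !ffunE leq_add2r.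
elim: s c ps {d ls} => [|c' s IHs] c /=; first by exists [::].
case/andP=> /(@pebbling_move_add _ _ e) cc' /IHs[t pt lt].
by exists (add_config c' e :: t); rewrite //= cc'.
Qed.

Lemma covers_le c d : (forall x, d x <= c x) -> covers c d.
Proof. by exists [::]. Qed.

Lemma covers_trans d c e : covers c d -> covers d e -> covers c e.
Proof.
case=> s ps ls de; set c' := last c s in ls.
(* The surplus of [c'] over [d] stays idle in the second phase; the truncated subtraction is exact
   because [c'] dominates [d]. *)
have {de}[t pt lt] := @covers_addr _ _ [ffun x => c' x - d x] de.
have def_c' : add_config d [ffun x => c' x - d x] = c'.
  by apply/ffunP=> x; rewrite !ffunE subnKC.
rewrite def_c' in pt lt; exists (s ++ t); first by rewrite cat_path ps.
move=> x; rewrite last_cat; apply: leq_trans (lt x).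
by rewrite ffunE leq_addr.
Qed.

Lemma covers_add c c' d d' :
  covers c d -> covers c' d' -> covers (add_config c c') (add_config d d').
Proof.
move=> cd c'd'; apply: covers_trans (covers_addr c' cd) _.
have addC a b : add_config a b = add_config b a.
  by apply/ffunP=> x; rewrite !ffunE addnC.
by rewrite ![add_config d _]addC; apply: covers_addr.
Qed.

(** Each plan uses only its own pebbles, so all of them can be carried out without interfering. *)
Lemma covers_sum (I : Type) (s : seq I) (F E : I -> config G) :
  (forall i, covers (F i) (E i)) ->
  covers [ffun x => \sum_(i <- s) F i x] [ffun x => \sum_(i <- s) E i x].
Proof.
move=> FE; elim: s => [|i s IHs].
  by apply: covers_le => x; rewrite !ffunE !big_nil.
apply: covers_trans (covers_trans (covers_add (FE i) IHs) _);
  by apply: covers_le => x; rewrite !ffunE big_cons.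
Qed.

Lemma covers_pile_adj u v k : adj u v -> covers (pile u k.*2) (pile v k).
Proof.
move=> uv; case: (@gather G k (pile u k.*2) u v uv) => [|s ps ls].
  by rewrite ffunE eqxx mul1n.
by exists s => // x; rewrite ffunE; case: eqP => // ->; rewrite mul1n.
Qed.

Lemma covers_pile_path u p k : path (@adj G) u p ->
  covers (pile u (k * 2 ^ size p)) (pile (last u p) k).
Proof.
elim: p u => [|v p IHp] u /=; first by move=> _; apply: covers_le; rewrite muln1.
case/andP=> uv /IHp; apply: covers_trans.
by rewrite expnS mulnCA mul2n; apply: covers_pile_adj.
Qed.

Lemma covers_pile_walk n u v k :
  is_walk n u v -> covers (pile u (k * 2 ^ n)) (pile v k).
Proof.
case/existsP=> p /andP[pth /eqP<-].
by rewrite -{1}(size_tuple p); apply: covers_pile_path.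
Qed.

(** Solvability is defined for configurations of size exactly [k]; larger ones are first trimmed to
    that size. *)
Lemma subconfig_size c k : k <= config_size c ->
  exists2 d, config_size d = k & forall x, d x <= c x.
Proof.
elim: k => [|k IHk] le; first by exists [ffun=> 0] => [|x];
  rewrite /config_size ?ffunE // big1 // => x; rewrite ffunE.
have [d sd ld] := IHk (ltnW le).
case: (pickP (fun x => d x < c x)) => [x ltx|none]; last first.
  suff: config_size c <= k by rewrite leqNgt le.
  by rewrite -sd; apply: leq_sum => x _; rewrite leqNgt none.
exists (add_config d (pile x 1)).
  rewrite -[k.+1]addn1 -sd /config_size.
  under eq_bigr => y _ do rewrite ffunE.
  rewrite big_split /=; congr (_ + _).
  rewrite (bigD1 x) //= ffunE eqxx big1 // => y /negPf ne.
  by rewrite ffunE ne.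
by move=> y; rewrite !ffunE; case: eqP => [->|_]; rewrite ?addn1 ?addn0.
Qed.

Lemma can_reach_pebbling_number c r :
  pebbling_number G <= config_size c -> can_reach c r.
Proof.
rewrite /pebbling_number; case: ex_minnP => k /asboolP solv _.
case/subconfig_size=> d sd ld.
apply/can_reach_covers; apply: covers_trans (covers_le ld) _.
exact/can_reach_covers/solv.
Qed.

Lemma dist_walk u v : is_walk (dist u v) u v.
Proof. by rewrite /dist; case: ex_minnP. Qed.

Lemma dist_refl u : dist u u = 0.
Proof.
rewrite /dist; case: ex_minnP => n _ min; apply/eqP; rewrite -leqn0.
by apply: min; apply/existsP; exists [tuple]; rewrite /= eqxx.
Qed.

End Covers.

(** * Transport along a graph homomorphism *)

Section Homomorphism.
Variables (K X : cgraph) (phi : K -> X).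
Hypothesis phi_adj : forall i j, adj i j -> adj (phi i) (phi j).

Lemma is_walk_hom n i j : is_walk n i j -> is_walk n (phi i) (phi j).
Proof.
case/existsP=> p /andP[pth /eqP<-]; apply/existsP; exists (map_tuple phi p).
by rewrite last_map eqxx andbT (homo_path phi_adj).
Qed.

Definition push (c : config K) : config X :=
  [ffun x => \sum_(i | phi i == x) c i].

Lemma push_add c d : push (add_config c d) = add_config (push c) (push d).
Proof.
apply/ffunP=> x; rewrite !ffunE -big_split.
by apply: eq_bigr => i _; rewrite ffunE.
Qed.

Lemma push_pile i k : push (pile i k) = pile (phi i) k.
Proof.
apply/ffunP=> x; rewrite !ffunE big_mkcond (bigD1 i) //= big1 ?addn0.
  by rewrite ffunE eqxx mul1n eq_sym; case: eqP; rewrite ?mul1n.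
by move=> j /negPf ne; rewrite ffunE ne; case: ifP.
Qed.

(** A move trades a pile of two at [u] for one pebble at [v] and leaves the rest [e] alone; as
    [push] is additive, only the edge from [phi u] to [phi v] matters. *)
Lemma covers_push_move c c' : pebbling_move c c' -> covers (push c) (push c').
Proof.
case/existsP=> u /existsP[v /and3P[uv le2 /eqP->]].
pose e : config K := [ffun x => c x - (x == u) * 2].
have -> : c = add_config (pile u 2) e.
  by apply/ffunP=> x; rewrite !ffunE; case: eqP => [->|_]; lia.
have -> : apply_move (add_config (pile u 2) e) u v = add_config (pile v 1) e.
  have /negPf neq : u != v by apply: contraTneq uv => ->; rewrite adj_irr.
  apply/ffunP=> x; rewrite !ffunE; case: (x =P u) => [->|_].
    by rewrite neq !eqxx; lia.
  by case: (x =P v) => [->|]; rewrite ?eqxx ?(eq_sym v) ?neq; lia.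
rewrite !push_add !push_pile; apply: covers_addr.
exact: (@covers_pile_adj X _ _ 1 (phi_adj uv)).
Qed.

Lemma covers_push_reach c i : can_reach c i -> covers (push c) (pile (phi i) 1).
Proof.
case/can_reach_covers=> s ps ls; apply: (@covers_trans _ (push (last c s))).
  elim: s c ps {ls} => [|c' s IHs] c /=; first by move=> _; apply: covers_le.
  by case/andP=> /covers_push_move cc' /IHs; apply: covers_trans.
apply: covers_le => x; rewrite -push_pile !ffunE.
exact: leq_sum.
Qed.

(** The core argument: [phi] places [K] as the root slice, [rho] projects onto [K], and [n u] is the
    length of the walk from [u] into that slice. *)
Lemma can_reach_stacks (rho : X -> K) (n : X -> nat) (c : config X) (r : K) :
  (forall u, is_walk (n u) u (phi (rho u))) ->
  pebbling_number K <= \sum_(u : X) c u %/ 2 ^ n u ->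
  can_reach c (phi r).
Proof.
move=> walk le; pose q u := c u %/ 2 ^ n u.
(* One pebble for each stack sent to [phi i]; hence [b] has the total number of stacks as its
   size. *)
pose b : config K := [ffun i => \sum_(u | rho u == i) q u].
have reach_b : can_reach b r.
  apply: can_reach_pebbling_number; apply: leq_trans le _.
  rewrite (partition_big rho xpredT) //=.
  by apply: leq_sum => i _; rewrite ffunE.
apply/can_reach_covers; apply: covers_trans (covers_push_reach reach_b).
have := covers_sum (index_enum X) (fun u => covers_pile_walk (q u) (walk u)).
move=> cov; apply: covers_trans (covers_trans cov _); apply: covers_le => x.
  rewrite ffunE (bigD1 x) //= big1 ?addn0 => [|u ne].
    by rewrite ffunE eqxx mul1n leq_divM.
  by rewrite ffunE eq_sym (negPf ne).
rewrite !ffunE; under [leqRHS]eq_bigr => u _ do rewrite ffunE eq_sym mulnbl.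
(* The pebbles arriving at [x] are regrouped by their [K]-coordinate to match [push b]. *)
rewrite -big_mkcond (partition_big rho (fun i => phi i == x)) //=.
apply: leq_sum => i /eqP phi_i; rewrite ffunE.
rewrite [leqRHS](eq_bigl (fun u => rho u == i)) // => u.
by case: (rho u =P i) => [->|_]; rewrite ?phi_i ?eqxx ?andbF.
Qed.

End Homomorphism.

Lemma mem_slice (G H : cgraph) (K : side) (j : cofactor G H K)
    (u : cprod G H) :
  (u \in slice j) = (coproj K u == j).
Proof.
case: K j u => /= j [g h] /=; apply/imsetP/eqP => [[i _ []] //|<-].
  by exists g.
by exists h.
Qed.

(** The root slice is at distance 0, where stacks are single pebbles, so its size is one more term
    of the same kind. *)
Lemma sum_stack (G H : cgraph) (K : side) (c : config (cprod G H))
    (r : cofactor G H K) :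
  (\sum_(j | j != r) stack c j (dist j r)) + slice_size c r
    = \sum_u c u %/ 2 ^ dist (coproj K u) r.
Proof.
rewrite [RHS](partition_big (@coproj G H K) xpredT) //= [RHS](bigD1 r) //= addnC.
congr (_ + _).
  rewrite /slice_size; apply: eq_big => u; rewrite mem_slice // => /eqP->.
  by rewrite dist_refl divn1.
apply: eq_bigr => j _; rewrite /stack.
by apply: eq_big => u; rewrite mem_slice // => /eqP->.
Qed.

Theorem theorem8 (G H : cgraph) (rG : G) (rH : H) (K : side)
    (c : config (cprod G H)) :
  ~ can_reach c ((rG, rH) : cprod G H) ->
  (\sum_(j : cofactor G H K | j != coproj K ((rG, rH) : cprod G H))
      stack c j (dist j (coproj K ((rG, rH) : cprod G H))))
    + slice_size c (coproj K ((rG, rH) : cprod G H)) + 1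
  <= pebbling_number (factor G H K).
Proof.
move=> unsolv; rewrite sum_stack addn1 ltnNge; apply/negP => le; case: unsolv.
(* Each inclusion of a factor serves twice: as [phi] when that factor is [K], and to lift shortest
   walks when it is the other one. *)
have adj1 (h : H) (g g' : G) :
    adj g g' -> adj ((g, h) : cprod G H) ((g', h) : cprod G H).
  by move=> gg'; rewrite /= /cprod_adj /= eqxx gg' orbT.
have adj2 (g : G) (h h' : H) :
    adj h h' -> adj ((g, h) : cprod G H) ((g, h') : cprod G H).
  by move=> hh'; rewrite /= /cprod_adj /= eqxx hh'.
case: K le => /= le.
  (* A shortest walk from [h] to [rH], lifted to the copy of [H] over [g], ends in the root slice at
     [(g, rH)]. *)
  apply: (can_reach_stacks (adj1 rH) (rho := fun u => u.1) rG _ le) => -[g h].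
  exact: (is_walk_hom (adj2 g) (dist_walk h rH)).
apply: (can_reach_stacks (adj2 rG) (rho := fun u => u.2) rH _ le) => -[g h].
exact: (is_walk_hom (adj1 h) (dist_walk g rG)).
Qed.
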